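(* maxAPEP$\langle\mathsf{SoD_U}\rangle$ (and thus D-APEP$\langle\mathsf{SoD_U}\rangle$) can be solved in FPT time $O^*(2^{k+k\log k})$, where $k=|R|$ is the number of resources.
   Context: An instance consists of a finite set $U$ of users, a finite set $R$ of resources, a base authorization relation $A_{\sf Bse}\subseteq U\times R$ with $A_{\sf Bse}(r)\neq\emptyset$ for all $r\in R$, and a set $C$ of $\mathsf{SoD_U}$ constraints. For $A\subseteq U\times R$, $A(r)=\{u\in U:(u,r)\in A\}$. A $\mathsf{SoD_U}$ constraint has the form $(r,r',\updownarrow,\forall)$ with $r,r'\in R$ and is satisfied by a complete $A$ iff $A(r)\cap A(r')=\emptyset$. $A$ is authorized if $A\subseteq A_{\sf Bse}$, complete if $A(r)\ne\emptyset$ for all $r\in R$, eligible if it satisfies every $c\in C$, and valid if it is authorized, complete and eligible. D-APEP$\langle\mathsf{SoD_U}\rangle$ asks whether a valid $A$ exists (and, if so, to find one); maxAPEP$\langle\mathsf{SoD_U}\rangle$ asks for a valid $A$ of maximum cardinality $|A|$, if a valid relation exists. $O^*$ suppresses factors polynomial in the input size as well as multiplicative constants. Logarithms are base 2. *)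

(* Defs.v *)
From Stdlib Require Import Reals.
From mathcomp Require Import all_boot.

Set Implicit Arguments.
Unset Strict Implicit.
Unset Printing Implicit Defensive.

Section Relations.

Variables (U R : finType).
Implicit Types (A B : {set U * R}) (C : {set R * R}).

Definition users_of A (r : R) : {set U} := [set u | (u, r) \in A].

(* The pair c = (r, r') stands for the SoD_U constraint (r, r', updown, forall);
   r = r' is not excluded. *)
Definition satisfies A (c : R * R) : bool :=
  users_of A c.1 :&: users_of A c.2 == set0.

Definition authorized B A : bool := A \subset B.

Definition complete A : bool := [forall r, users_of A r != set0].

Definition eligible C A : bool := [forall c in C, satisfies A c].

End Relations.

Record instance := Instance {
  user : finType;
  resource : finType;
  base : {set user * resource};
  constraints : {set resource * resource};
  base_neq0 : forall r, users_of base r != set0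
}.

Definition authorization (I : instance) := {set user I * resource I}.

Definition valid (I : instance) (A : authorization I) : bool :=
  [&& authorized (base I) A, complete A & eligible (constraints I) A].

(* A search problem is given by the correct answers on each instance; the answer
   None is the report that there is no valid relation. *)
Definition problem := forall I : instance, option (authorization I) -> Prop.

Definition D_APEP_SoD_U : problem := fun I o =>
  match o with
  | Some A => valid A
  | None => forall A : authorization I, ~~ valid A
  end.

Definition maxAPEP_SoD_U : problem := fun I o =>
  match o with
  | Some A => valid A /\ forall B : authorization I, valid B -> #|B| <= #|A|
  | None => forall A : authorization I, ~~ valid A
  end.

(* Machine model: Jones' WHILE language over binary trees. A value is to be
   thought of as a pointer to an immutable cell, so that each constructor of an
   expression, and each test and assignment, takes constant time on a
   random-access machine. There is no equality test between trees. *)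
Inductive tree := Leaf | Node of tree & tree.

Fixpoint tree_size (v : tree) : nat :=
  if v is Node a b then (tree_size a + tree_size b).+1 else 1.

Inductive expr :=
  | Var of nat
  | Nil
  | Cons of expr & expr
  | Hd of expr
  | Tl of expr.

Inductive cmd :=
  | Assign of nat & expr
  | Seq of cmd & cmd
  | If of expr & cmd & cmd
  | While of expr & cmd.

Definition store := nat -> tree.

Definition update (s : store) (x : nat) (v : tree) : store :=
  fun y => if y == x then v else s y.

(* As in Jones' language, both projections of the empty tree are empty. *)
Fixpoint eval (s : store) (e : expr) : tree :=
  match e with
  | Var x => s x
  | Nil => Leaf
  | Cons a b => Node (eval s a) (eval s b)
  | Hd a => if eval s a is Node v _ then v else Leaf
  | Tl a => if eval s a is Node _ v then v else Leaf
  end.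

Fixpoint expr_cost (e : expr) : nat :=
  match e with
  | Var _ | Nil => 1
  | Cons a b => (expr_cost a + expr_cost b).+1
  | Hd a | Tl a => (expr_cost a).+1
  end.

Definition truth (v : tree) : bool := if v is Node _ _ then true else false.

(* exec p s s' t: started in s, p terminates in s' after t steps. *)
Inductive exec : cmd -> store -> store -> nat -> Prop :=
  | ExecAssign x e s :
      exec (Assign x e) s (update s x (eval s e)) (expr_cost e).+1
  | ExecSeq p q s s1 s2 t1 t2 :
      exec p s s1 t1 -> exec q s1 s2 t2 -> exec (Seq p q) s s2 (t1 + t2).+1
  | ExecIfTrue e p q s s1 t :
      truth (eval s e) -> exec p s s1 t ->
      exec (If e p q) s s1 (expr_cost e + t).+1
  | ExecIfFalse e p q s s1 t :
      ~~ truth (eval s e) -> exec q s s1 t ->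
      exec (If e p q) s s1 (expr_cost e + t).+1
  | ExecWhileTrue e p s s1 s2 t1 t2 :
      truth (eval s e) -> exec p s s1 t1 -> exec (While e p) s1 s2 t2 ->
      exec (While e p) s s2 (expr_cost e + t1 + t2).+1
  | ExecWhileFalse e p s :
      ~~ truth (eval s e) -> exec (While e p) s s (expr_cost e).+1.

(* In particular, asserting that some run meets a time bound is the same as
   asserting it of the run. *)
Lemma exec_deterministic p s s1 t1 s2 t2 :
  exec p s s1 t1 -> exec p s s2 t2 -> s1 = s2 /\ t1 = t2.
Proof.
move=> E1; elim: E1 s2 t2 => {p s s1 t1} *;
  match goal with E : exec _ _ _ _ |- _ =>
    inversion E; subst; clear E; try by []; try congruence
  end;
  repeat match goal with
  | IH : (forall s t, exec ?p ?u s t -> _), E : exec ?p ?u _ _ |- _ =>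
      have [? ?] := IH _ _ E; subst; clear E
  end; by [] || (exfalso; match goal with
    H : is_true (~~ ?b), H' : is_true ?b |- _ => by rewrite H' in H end).
Qed.

Definition encode_bool (b : bool) : tree := if b then Node Leaf Leaf else Leaf.

Definition encode_seq (s : seq tree) : tree := foldr Node Leaf s.

(* The rows of the Boolean matrix of A, in the order of enum. *)
Definition encode_relation (S T : finType) (A : {set S * T}) : tree :=
  encode_seq [seq encode_seq [seq encode_bool ((x, y) \in A) | y <- enum T]
             | x <- enum S].

Definition encode_instance (I : instance) : tree :=
  Node (encode_relation (base I)) (encode_relation (constraints I)).

Definition encode_answer (I : instance) (o : option (authorization I)) : tree :=
  if o is Some A then Node (encode_relation A) Leaf else Leaf.

Definition input_size (I : instance) : nat := tree_size (encode_instance I).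

(* Variable 0 holds the input at the start and the output at the end. *)
Definition initial (v : tree) : store := update (fun=> Leaf) 0 v.

Local Open Scope R_scope.

(* P is solved by a single program in time O*(f k), where k is the number of
   resources. As input_size I >= 1, the factors c * input_size I ^ d dominate
   all polynomials in the input size. *)
Definition solvable_in_O_star (P : problem) (f : nat -> R) : Prop :=
  exists (p : cmd) (c d : nat), forall I : instance,
  exists (o : option (authorization I)) (s : store) (t : nat),
    [/\ exec p (initial (encode_instance I)) s t,
        s 0%N = encode_answer o,
        P I o
      & INR t <= INR (c * input_size I ^ d)%N * f #|resource I| ].

(* ln 0 = 0; in the term k log k this value is moreover multiplied by k = 0. *)
Definition log2 (x : R) : R := ln x / ln 2.

(* Main.v *)
(* Satisfying the constraints means giving each user u an independent set f u of
   the constraint graph inside base(u), and completeness means that these sets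
   cover all resources. Going through the users, one keeps a table with, for each
   set T of resources, a best assignment of the users seen so far that covers T.
   A user is processed by trying all old entries and all independent sets for
   every new T, in 8^k polynomial steps. This suffices, because
   2^(k + k log k) = (2 k)^k >= 8^k for k >= 4.

   The algorithm is written in a small language whose only loop is the fold over
   lists, with a compositional cost; its compilation to WHILE preserves the cost
   up to a constant factor. *)

Require Import Defs.
From Stdlib Require Import Reals Lra.
From mathcomp Require Import all_boot zify.

Set Implicit Arguments.
Unset Strict Implicit.
Unset Printing Implicit Defensive.

(** * A fold language and its compilation *)

(* FVar i is a de Bruijn level: it counts binders from the outermost one, so
   FLet and FFold append to the environment (FFold appends the accumulator and
   the current items of the two lists, which are read in lockstep). FCall vs f
   runs f in the environment made of the variables vs alone. *)
Inductive fexp :=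
  | FVar of nat
  | FNil
  | FCons of fexp & fexp
  | FHd of fexp
  | FTl of fexp
  | FIf of fexp & fexp & fexp
  | FLet of fexp & fexp
  | FCall of seq nat & fexp
  | FFold of fexp & fexp & fexp & fexp.

Definition hd (v : tree) : tree := if v is Node a _ then a else Leaf.
Definition tl (v : tree) : tree := if v is Node _ b then b else Leaf.

(** The second list is read with [hd] and [tl], so a list that is too short is padded with [Leaf]; a
    fold over a single list passes [FNil]. *)
Fixpoint fold2 (F : tree -> tree -> tree -> tree) (l m acc : tree) : tree :=
  if l is Node x l' then fold2 F l' (tl m) (F acc x (hd m)) else acc.

Fixpoint fold2_cost (F : tree -> tree -> tree -> tree)
    (G : tree -> tree -> tree -> nat) (l m acc : tree) : nat :=
  if l is Node x l' then
    (G acc x (hd m) + fold2_cost F G l' (tl m) (F acc x (hd m))).+1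
  else 0.

Fixpoint feval (env : seq tree) (e : fexp) : tree :=
  match e with
  | FVar i => nth Leaf env i
  | FNil => Leaf
  | FCons a b => Node (feval env a) (feval env b)
  | FHd a => hd (feval env a)
  | FTl a => tl (feval env a)
  | FIf c a b => if truth (feval env c) then feval env a else feval env b
  | FLet a b => feval (rcons env (feval env a)) b
  | FCall vs f => feval [seq nth Leaf env i | i <- vs] f
  | FFold l m a b =>
      fold2 (fun acc x y => feval (env ++ [:: acc; x; y]) b)
        (feval env l) (feval env m) (feval env a)
  end.

(** A call adds no cost of its own: compiling it only renames variables and emits no command. *)
Fixpoint fcost (env : seq tree) (e : fexp) : nat :=
  match e with
  | FVar _ | FNil => 1
  | FCons a b => (fcost env a + fcost env b).+1
  | FHd a | FTl a => (fcost env a).+1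
  | FIf c a b =>
      (fcost env c +
       if truth (feval env c) then fcost env a else fcost env b).+1
  | FLet a b => (fcost env a + fcost (rcons env (feval env a)) b).+1
  | FCall vs f => fcost [seq nth Leaf env i | i <- vs] f
  | FFold l m a b =>
      (fcost env l + fcost env m + fcost env a +
       fold2_cost (fun acc x y => feval (env ++ [:: acc; x; y]) b)
         (fun acc x y => fcost (env ++ [:: acc; x; y]) b)
         (feval env l) (feval env m) (feval env a)).+1
  end.

(* The i-th variable is found by evaluating the i-th expression of regs; the
   result goes to register d, and all registers from d on are free. *)
Fixpoint compile (regs : seq expr) (d : nat) (e : fexp) : cmd :=
  match e with
  | FVar i => Assign d (nth Defs.Nil regs i)
  | FNil => Assign d Defs.Nil
  | FCons a b =>
      Seq (compile regs d a)
        (Seq (compile regs d.+1 b) (Assign d (Defs.Cons (Var d) (Var d.+1))))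
  | FHd a => Seq (compile regs d a) (Assign d (Hd (Var d)))
  | FTl a => Seq (compile regs d a) (Assign d (Tl (Var d)))
  | FIf c a b =>
      Seq (compile regs d c) (If (Var d) (compile regs d a) (compile regs d b))
  | FLet a b =>
      Seq (compile regs d a)
        (Seq (compile (rcons regs (Var d)) d.+1 b) (Assign d (Var d.+1)))
  | FCall vs f => compile [seq nth Defs.Nil regs i | i <- vs] d f
  | FFold l m a b =>
      Seq (compile regs d l) (Seq (compile regs d.+1 m)
        (Seq (compile regs d.+2 a)
          (Seq
            (While (Var d)
              (Seq (Assign d.+3 (Hd (Var d)))
              (Seq (Assign d.+4 (Hd (Var d.+1)))
              (Seq (compile (regs ++ [:: Var d.+2; Var d.+3; Var d.+4])
                      (d + 5) b)
              (Seq (Assign d.+2 (Var (d + 5)))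
              (Seq (Assign d (Tl (Var d)))
                (Assign d.+1 (Tl (Var d.+1)))))))))
            (Assign d (Var d.+2)))))
  end.

(** * Correctness and cost of the compilation *)

Definition same_below d (s s' : store) := forall y, y < d -> s' y = s y.

(** Quantifying over all stores that agree below [d] makes the invariant survive any scratch use of
    the registers from [d] on. Cost 1 restricts [regs] to variables and the empty tree, so a lookup
    takes constant time. *)
Definition holds d (s : store) (regs : seq expr) (env : seq tree) :=
  all (fun r => expr_cost r == 1) regs /\
  forall s', same_below d s s' -> [seq eval s' r | r <- regs] = env.

Lemma updateE s x v : update s x v x = v.
Proof. by rewrite /update eqxx. Qed.

Lemma updateN s x v y : y != x -> update s x v y = s y.
Proof. by rewrite /update => /negbTE ->. Qed.

Lemma same_belowW d d' s s' : d <= d' -> same_below d' s s' -> same_below d s s'.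
Proof. by move=> le_d h y lt_y; apply: h; apply: leq_trans le_d. Qed.

Lemma same_below_trans d s1 s2 s3 :
  same_below d s1 s2 -> same_below d s2 s3 -> same_below d s1 s3.
Proof. by move=> h1 h2 y lt_y; rewrite h2 // h1. Qed.

Lemma same_below_update d s s' x v :
  d <= x -> same_below d s s' -> same_below d s (update s' x v).
Proof. by move=> le_dx h y lt_y; rewrite updateN ?h //; lia. Qed.

Lemma holdsW d d' s s' regs env :
  d <= d' -> same_below d s s' -> holds d s regs env -> holds d' s' regs env.
Proof.
move=> le_d ss [c h]; split=> // s2 s's2; apply: h; apply: same_below_trans ss _.
exact: same_belowW s's2.
Qed.

Lemma nth_eval s regs i :
  nth Leaf [seq eval s r | r <- regs] i = eval s (nth Defs.Nil regs i).
Proof.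
have [lt_i|le_i] := ltnP i (size regs); first by rewrite (nth_map Defs.Nil).
by rewrite !nth_default ?size_map.
Qed.

Lemma nth_cost regs i :
  all (fun r => expr_cost r == 1) regs -> expr_cost (nth Defs.Nil regs i) = 1.
Proof.
move=> /(all_nthP Defs.Nil) c.
have [lt_i|le_i] := ltnP i (size regs); last by rewrite nth_default.
exact/eqP/c.
Qed.

Lemma holds_call d s regs env vs :
  holds d s regs env ->
  holds d s [seq nth Defs.Nil regs i | i <- vs] [seq nth Leaf env i | i <- vs].
Proof.
move=> [c h]; split; first by rewrite all_map; apply/allP => i _ /=; rewrite nth_cost.
move=> s' ss'; rewrite -map_comp; apply: eq_map => i /=.
by rewrite -nth_eval h.
Qed.

Lemma holds_cat d s regs env xs :
  (forall x, x \in xs -> x < d) -> holds d s regs env ->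
  holds d s (regs ++ [seq Var x | x <- xs]) (env ++ [seq s x | x <- xs]).
Proof.
move=> lt_xs [c h]; split; first by rewrite all_cat c all_map; apply/allP.
move=> s' ss'; rewrite map_cat h // -map_comp; congr cat.
by apply/eq_in_map => x /lt_xs /ss'.
Qed.

(** Induction on the list in register [d]; the correctness of the compiled body is a hypothesis, to
    be supplied by the induction in [exec_compile]. A round takes 21 steps outside the body, paid
    for by the successor in [fold2_cost]; the last, failing test takes 2. *)
Lemma exec_loop regs d env b :
  (forall s, holds (d + 5) s (regs ++ [:: Var d.+2; Var d.+3; Var d.+4])
               (env ++ [:: s d.+2; s d.+3; s d.+4]) ->
   exists s' t, [/\ exec (compile (regs ++ [:: Var d.+2; Var d.+3; Var d.+4])
                            (d + 5) b) s s' t,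
     s' (d + 5) = feval (env ++ [:: s d.+2; s d.+3; s d.+4]) b,
     same_below (d + 5) s s' &
     t <= 30 * fcost (env ++ [:: s d.+2; s d.+3; s d.+4]) b]) ->
  forall l s, s d = l -> holds d s regs env ->
  exists s' t, [/\
    exec (While (Var d)
              (Seq (Assign d.+3 (Hd (Var d)))
              (Seq (Assign d.+4 (Hd (Var d.+1)))
              (Seq (compile (regs ++ [:: Var d.+2; Var d.+3; Var d.+4])
                      (d + 5) b)
              (Seq (Assign d.+2 (Var (d + 5)))
              (Seq (Assign d (Tl (Var d)))
                (Assign d.+1 (Tl (Var d.+1))))))))) s s' t,
    s' d.+2 = fold2 (fun acc x y => feval (env ++ [:: acc; x; y]) b)
                l (s d.+1) (s d.+2),
    same_below d s s' &
    t <= 2 + 30 * fold2_cost (fun acc x y => feval (env ++ [:: acc; x; y]) b)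
              (fun acc x y => fcost (env ++ [:: acc; x; y]) b)
              l (s d.+1) (s d.+2)].
Proof.
move=> Hb; elim=> [|x _ l IH] s sd hs /=.
  exists s, 2; split=> //; apply: (ExecWhileFalse (e := Var d)) => /=.
  by rewrite sd.
(* [s2] is the store in which the body starts; [s6] below is the store at the end of the round. *)
pose s1 := update s d.+3 x; pose s2 := update s1 d.+4 (hd (s1 d.+1)).
have ss2 : same_below d s s2 by do 2!(apply: same_below_update; first lia).
have h2 : holds (d + 5) s2 (regs ++ [:: Var d.+2; Var d.+3; Var d.+4])
               (env ++ [:: s2 d.+2; s2 d.+3; s2 d.+4]).
  apply: (@holds_cat _ _ _ _ [:: d.+2; d.+3; d.+4]).
    by move=> y; rewrite !inE; lia.
  by apply: holdsW hs => //; lia.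
have [s3 [t3 [e3 v3 ss3 le3]]] := Hb _ h2.
have E2 : [/\ s2 d.+2 = s d.+2, s2 d.+3 = x & s2 d.+4 = hd (s d.+1)].
  split; rewrite /s2 /s1.
  - by rewrite !updateN //; lia.
  - by rewrite updateN ?updateE //; lia.
  - by rewrite updateE updateN //; lia.
case: E2 => E22 E23 E24; rewrite {}E22 {}E23 {}E24 in v3 le3.
pose s4 := update s3 d.+2 (s3 (d + 5)); pose s5 := update s4 d (tl (s4 d)).
pose s6 := update s5 d.+1 (tl (s5 d.+1)).
have s3d y : y < d.+2 -> s3 y = s y.
  move=> lt_y; rewrite ss3; last by lia.
  by rewrite /s2 /s1 !updateN //; lia.
have ss6 : same_below d s s6.
  do 3!(apply: same_below_update; first lia); move=> y lt_y; apply: s3d; lia.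
have E : [/\ s6 d = l, s6 d.+1 = tl (s d.+1) &
     s6 d.+2 = feval (env ++ [:: s d.+2; x; hd (s d.+1)]) b].
  split.
  - by rewrite /s6 updateN /s5 ?updateE /s4 ?updateN ?s3d ?sd //; lia.
  - by rewrite /s6 updateE /s5 /s4 !updateN ?s3d //; lia.
  - by rewrite /s6 /s5 updateN ?updateN /s4 ?updateE //; lia.
case: E => E0 E1 E2.
have [s7 [t7 [e7 v7 ss7 le7]]] := IH _ E0 (holdsW (leqnn _) ss6 hs).
rewrite E1 E2 in v7 le7; exists s7; eexists; split.
- apply: (ExecWhileTrue (s1 := s6) _ _ e7); first by rewrite /= sd.
  apply: ExecSeq; first exact: ExecAssign.
  apply: ExecSeq; first exact: ExecAssign.
  rewrite /= sd; apply: ExecSeq; first exact: e3.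
  apply: ExecSeq; first exact: ExecAssign.
  apply: ExecSeq; exact: ExecAssign.
- by rewrite v7.
- exact: same_below_trans ss7.
- by rewrite /=; lia.
Qed.

(** Induction on the expression, for all [regs] and [d]. Apart from calls, each construct emits a
    few steps besides those of its parts, and 30 times the successor in its [fcost] covers them. *)
Lemma exec_compile e regs d env s :
  holds d s regs env ->
  exists s' t, [/\ exec (compile regs d e) s s' t, s' d = feval env e,
    same_below d s s' & t <= 30 * fcost env e].
Proof.
elim: e regs d env s => [i||a IHa b IHb|a IHa|a IHa|c IHc a IHa b IHb|a IHa b IHb
  |vs f IH|l IHl m IHm a IHa b IHb] regs d env s hs /=.
- eexists; eexists; split; first exact: ExecAssign.
  + by rewrite updateE -nth_eval; case: hs => _ ->.
  + exact: same_below_update.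
  + by rewrite nth_cost //; case: hs.
- eexists; eexists; split; first exact: ExecAssign.
  + by rewrite updateE.
  + exact: same_below_update.
  + by [].
- have [s1 [t1 [e1 v1 ss1 le1]]] := IHa _ _ _ _ hs.
  have [s2 [t2 [e2 v2 ss2 le2]]] := IHb _ _ _ _ (holdsW (leqnSn d) ss1 hs).
  eexists; eexists; split.
  + apply: ExecSeq; first exact: e1.
    by apply: ExecSeq; first exact: e2; exact: ExecAssign.
  + by rewrite updateE /= v2 ss2 ?v1.
  + apply: same_below_update => //; apply: same_below_trans ss1 _.
    exact: same_belowW ss2.
  + by rewrite /=; lia.
- have [s1 [t1 [e1 v1 ss1 le1]]] := IHa _ _ _ _ hs.
  eexists; eexists; split.
  + by apply: ExecSeq; first exact: e1; exact: ExecAssign.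
  + by rewrite updateE /= v1.
  + exact: same_below_update.
  + by rewrite /=; lia.
- have [s1 [t1 [e1 v1 ss1 le1]]] := IHa _ _ _ _ hs.
  eexists; eexists; split.
  + by apply: ExecSeq; first exact: e1; exact: ExecAssign.
  + by rewrite updateE /= v1.
  + exact: same_below_update.
  + by rewrite /=; lia.
- have [s1 [t1 [e1 v1 ss1 le1]]] := IHc _ _ _ _ hs.
  have hs1 := holdsW (leqnn d) ss1 hs.
  have [tc|fc] := boolP (truth _).
  + have [s2 [t2 [e2 v2 ss2 le2]]] := IHa _ _ _ _ hs1.
    exists s2; eexists; split.
    * by apply: ExecSeq; first exact: e1; apply: ExecIfTrue e2; rewrite /= v1.
    * by [].
    * exact: same_below_trans ss2.
    * by rewrite /=; lia.
  + have [s2 [t2 [e2 v2 ss2 le2]]] := IHb _ _ _ _ hs1.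
    exists s2; eexists; split.
    * by apply: ExecSeq; first exact: e1; apply: ExecIfFalse e2; rewrite /= v1.
    * by [].
    * exact: same_below_trans ss2.
    * by rewrite /=; lia.
- have [s1 [t1 [e1 v1 ss1 le1]]] := IHa _ _ _ _ hs.
  have h1 : holds d.+1 s1 (rcons regs (Var d)) (rcons env (feval env a)).
    rewrite -!cats1 -v1; apply: (@holds_cat _ _ _ _ [:: d]).
      by move=> x; rewrite inE => /eqP ->.
    by apply: holdsW hs.
  have [s2 [t2 [e2 v2 ss2 le2]]] := IHb _ _ _ _ h1.
  eexists; eexists; split.
  + apply: ExecSeq; first exact: e1.
    by apply: ExecSeq; first exact: e2; exact: ExecAssign.
  + by rewrite updateE /= v2.
  + apply: same_below_update => //; apply: same_below_trans ss1 _.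
    exact: same_belowW ss2.
  + by rewrite /=; lia.
- exact: IH (holds_call _ hs).
- have [s1 [t1 [e1 v1 ss1 le1]]] := IHl _ _ _ _ hs.
  have [s2 [t2 [e2 v2 ss2 le2]]] := IHm _ _ _ _ (holdsW (leqnSn d) ss1 hs).
  have ss12 : same_below d s s2.
    exact: same_below_trans ss1 (same_belowW _ ss2).
  have le_d2 : d <= d.+2 by lia.
  have [s3 [t3 [e3 v3 ss3 le3]]] := IHa _ _ _ _ (holdsW le_d2 ss12 hs).
  have ss13 : same_below d s s3.
    exact: same_below_trans ss12 (same_belowW _ ss3).
  have s3d : s3 d = feval env l by rewrite ss3 ?ss2.
  have [s4 [t4 [e4 v4 ss4 le4]]] := exec_loop (fun s => @IHb _ _ _ s) s3d
    (holdsW (leqnn d) ss13 hs).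
  rewrite v3 ss3 // v2 in v4 le4.
  eexists; eexists; split.
  + apply: ExecSeq; first exact: e1.
    apply: ExecSeq; first exact: e2.
    apply: ExecSeq; first exact: e3.
    by apply: ExecSeq; first exact: e4; exact: ExecAssign.
  + by rewrite updateE /= v4.
  + by apply: same_below_update => //; exact: same_below_trans ss4.
  + by rewrite /=; lia.
Qed.

(** * Programs on encoded sets of resources *)

(* The second case of the second hypothesis is that of a fold over one list. *)
Lemma fold2_spec (X : Type) (f g : X -> tree) env l m a b
    (P : seq X -> tree -> Prop) c xs :
  feval env l = encode_seq [seq f x | x <- xs] ->
  feval env m = encode_seq [seq g x | x <- xs] \/
    feval env m = Leaf /\ (forall x, g x = Leaf) ->
  P [::] (feval env a) ->
  (forall s1 x s2 acc, xs = s1 ++ x :: s2 -> P s1 acc ->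
     P (rcons s1 x) (feval (env ++ [:: acc; f x; g x]) b) /\
     fcost (env ++ [:: acc; f x; g x]) b <= c) ->
  P xs (feval env (FFold l m a b)) /\
  fcost env (FFold l m a b) <=
    (fcost env l + fcost env m + fcost env a + size xs * c.+1).+1.
Proof.
move=> /= -> hm Pa step; rewrite ltnS leq_add2l.
(* The prefix already read, at first empty, is generalized for the induction. *)
rewrite -{1}[xs]/([::] ++ xs); move: step.
rewrite -{1}[xs]/([::] ++ xs).
elim: xs [::] (feval env m) (feval env a) hm Pa
  => [|x xs IH] s1 vm acc hm Pa step /=; first by rewrite cats0.
have -> : hd vm = g x by case: hm => [->|[-> ->]].
have [Pb le_c] := step _ _ _ _ erefl Pa.
rewrite -cat_rcons.
have [|s2 y s3 acc' e|hP hc] := IH (rcons s1 x) (tl vm) _ _ Pb.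
- by case: hm => [->|[-> h]]; [left | right].
- by apply: step; rewrite -cat_rcons; exact: e.
- by split; [exact: hP | rewrite mulSn; lia].
Qed.

(** * Set operations and the dynamic program, written as folds *)

Definition FTrue := FCons FNil FNil.

Definition disjoint_p :=
  FFold (FVar 0) (FVar 1) FTrue
    (FIf (FVar 3) (FIf (FVar 4) FNil (FVar 2)) (FVar 2)).

Definition subset_p :=
  FFold (FVar 0) (FVar 1) FTrue
    (FIf (FVar 3) (FIf (FVar 4) (FVar 2) FNil) (FVar 2)).

(** The rows of the constraint matrix are read in lockstep with the set: the row of each member must
    miss the set. *)
Definition independent_p :=
  FFold (FVar 0) (FVar 1) FTrue
    (FIf (FVar 4) (FIf (FCall [:: 3; 1] disjoint_p) (FVar 2) FNil) (FVar 2)).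

Definition rev_p := FFold (FVar 0) FNil FNil (FCons (FVar 2) (FVar 1)).

(** A fold that conses its results reverses them, hence the call of [rev_p]. *)
Definition union_p :=
  FLet (FFold (FVar 0) (FVar 1) FNil
         (FCons (FIf (FVar 3) (FVar 3) (FVar 4)) (FVar 2)))
    (FCall [:: 2] rev_p).

(** One round per row of the constraint matrix, hence per resource; each round doubles the list by
    prefixing either bit to every string. *)
Definition subsets_p :=
  FFold (FVar 0) FNil (FCons FNil FNil)
    (FFold (FVar 1) FNil FNil
       (FCons (FCons FTrue (FVar 5)) (FCons (FCons FNil (FVar 5)) (FVar 4)))).

Definition independents_p :=
  FFold (FVar 1) FNil FNil
    (FIf (FCall [:: 0; 3] independent_p) (FCons (FVar 3) (FVar 2)) (FVar 2)).

Definition const_p := FFold (FVar 0) FNil FNil (FCons (FVar 1) (FVar 2)).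

Definition count_p :=
  FFold (FVar 0) FNil (FVar 1) (FIf (FVar 3) (FCons FNil (FVar 2)) (FVar 2)).

(** Computes the truncated difference of the second and the first unary number, which is nonempty
    iff the first is smaller. *)
Definition lt_p := FFold (FVar 0) FNil (FVar 1) (FTl (FVar 2)).

(* Plans are headed by their value, and values are positive; so a missing plan,
   Leaf, loses to every plan since hd Leaf = Leaf. *)
Definition better_p :=
  FLet (FHd (FVar 0)) (FLet (FHd (FVar 1))
    (FIf (FCall [:: 2; 3] lt_p) (FVar 1) (FVar 0))).

(* Variables: target set, row of the user, table entry for the previous users,
   set given to the user, best plan so far. *)
Definition extend_p :=
  FIf (FCall [:: 3; 1] subset_p)
    (FLet (FHd (FVar 2))
    (FLet (FCall [:: 3; 5] union_p)
      (FIf (FCall [:: 0; 6] subset_p)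
        (FLet (FHd (FTl (FVar 2)))
        (FLet (FCons (FCall [:: 3; 7] count_p)
                     (FCons (FVar 3) (FTl (FTl (FVar 2)))))
          (FCall [:: 4; 8] better_p)))
        (FVar 4))))
    (FVar 4).

(** Variables: target set, row of the user, old table, independent sets. Every pair of an old entry
    and an independent set is tried. *)
Definition best_p :=
  FFold (FVar 2) FNil FNil
    (FFold (FVar 3) FNil (FVar 4) (FCall [:: 0; 1; 5; 8; 7] extend_p)).

(** Variables: row of the user, old table, independent sets, all sets. A target for which no plan is
    found gets no entry. *)
Definition step_p :=
  FFold (FVar 3) FNil FNil
    (FLet (FCall [:: 5; 0; 1; 2] best_p)
      (FIf (FVar 7) (FCons (FCons (FVar 5) (FVar 7)) (FVar 4)) (FVar 4))).

Definition final_p :=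
  FFold (FVar 1) FNil FNil
    (FLet (FHd (FVar 3))
      (FIf (FCall [:: 0; 5] subset_p)
        (FLet (FTl (FVar 3)) (FCall [:: 2; 6] better_p))
        (FVar 2))).

Definition loop_p :=
  FFold (FVar 0) FNil (FVar 1) (FCall [:: 5; 4; 2; 3] step_p).

(** Each user's set is put in front of those of the earlier users, so the base rows are reversed
    first; the tail of the final plan is then the encoded relation. The initial table has a single
    plan, without users and of value 1, for the empty set. *)
Definition main_p :=
  FLet (FHd (FVar 0))
  (FLet (FTl (FVar 0))
  (FLet (FCall [:: 2] subsets_p)
  (FLet (FCall [:: 2; 3] independents_p)
  (FLet FNil
  (FLet (FCall [:: 2; 5] const_p)
  (FLet FTrue
  (FLet (FCall [:: 2; 7] const_p)
  (FLet (FCall [:: 1] rev_p)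
  (FLet (FCons (FCons (FVar 6) (FCons FTrue FNil)) FNil)
  (FLet (FCall [:: 9; 10; 4; 3] loop_p)
  (FLet (FCall [:: 8; 11] final_p)
    (FIf (FVar 12) (FCons (FTl (FVar 12)) FNil) FNil)))))))))))).

(** * Values and costs of the set operations *)

Lemma truth_encode b : truth (encode_bool b) = b.
Proof. by case: b. Qed.

(** As for the later programs, [rev_p] becomes opaque after its specification, so that [/=] leaves
    calls of it intact for rewriting. *)
Lemma rev_spec s :
  feval [:: encode_seq s] rev_p = encode_seq (rev s) /\
  fcost [:: encode_seq s] rev_p <= 4 * (size s).+1.
Proof.
have [|||s1 x s2 acc _ ->|-> hc] := @fold2_spec _ id (fun=> Leaf)
    [:: encode_seq s] (FVar 0) FNil FNil (FCons (FVar 2) (FVar 1))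
    (fun s1 acc => acc = encode_seq (rev s1)) 3 s.
- by rewrite map_id.
- by right.
- by [].
- by rewrite rev_rcons.
- by split=> //; apply: leq_trans hc _; rewrite /=; lia.
Qed.
#[global] Opaque rev_p.

(* lia needs a rigid form: the cardinal can elaborate to distinct terms, as R is
   seen as a finType or as an eqType. *)
Definition dim (R : finType) := #|R|.

Section Sets.

Variable R : finType.
Implicit Types S T : {set R}.

Lemma size_enum : size (enum R) = dim R.
Proof. by rewrite -cardE. Qed.

Definition encode_set S := encode_seq [seq encode_bool (r \in S) | r <- enum R].

Lemma disjoint_spec S T :
  feval [:: encode_set S; encode_set T] disjoint_p =
    encode_bool [disjoint S & T] /\
  fcost [:: encode_set S; encode_set T] disjoint_p <= 10 * (dim R).+1.
Proof.
have [|||s1 x s2 acc _ ->|-> hc] := @fold2_spec _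
    (fun r => encode_bool (r \in S)) (fun r => encode_bool (r \in T))
    [:: encode_set S; encode_set T] (FVar 0) (FVar 1) FTrue
    (FIf (FVar 3) (FIf (FVar 4) FNil (FVar 2)) (FVar 2))
    (fun s1 acc => acc =
      encode_bool (all (fun r => ~~ ((r \in S) && (r \in T))) s1)) 5 (enum R).
- by [].
- by left.
- by [].
- by rewrite all_rcons /= !truth_encode; case: (x \in S); case: (x \in T).
- split; last by apply: leq_trans hc _; rewrite /= size_enum; lia.
  congr encode_bool; rewrite disjoint_subset; apply/allP/subsetP => h r.
    by move=> Sr; have := h r (mem_enum _ _); rewrite Sr inE.
  by move=> _; apply/negP => /andP [/h]; rewrite inE => /negP.
Qed.
#[global] Opaque disjoint_p.

Lemma subset_spec S T :
  feval [:: encode_set S; encode_set T] subset_p = encode_bool (S \subset T) /\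
  fcost [:: encode_set S; encode_set T] subset_p <= 10 * (dim R).+1.
Proof.
have [|||s1 x s2 acc _ ->|-> hc] := @fold2_spec _
    (fun r => encode_bool (r \in S)) (fun r => encode_bool (r \in T))
    [:: encode_set S; encode_set T] (FVar 0) (FVar 1) FTrue
    (FIf (FVar 3) (FIf (FVar 4) (FVar 2) FNil) (FVar 2))
    (fun s1 acc => acc =
      encode_bool (all (fun r => (r \in S) ==> (r \in T)) s1)) 5 (enum R).
- by [].
- by left.
- by [].
- by rewrite all_rcons /= !truth_encode; case: (x \in S); case: (x \in T).
- split; last by apply: leq_trans hc _; rewrite /= size_enum; lia.
  congr encode_bool; apply/allP/subsetP => h r; last by move=> _; apply/implyP/h.
  by move=> Sr; have := h r (mem_enum _ _); rewrite Sr.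
Qed.
#[global] Opaque subset_p.

Lemma union_spec S T :
  feval [:: encode_set S; encode_set T] union_p = encode_set (S :|: T) /\
  fcost [:: encode_set S; encode_set T] union_p <= 20 * (dim R).+1.
Proof.
have [|||s1 x s2 acc _ ->|hv hc] := @fold2_spec _
    (fun r => encode_bool (r \in S)) (fun r => encode_bool (r \in T))
    [:: encode_set S; encode_set T] (FVar 0) (FVar 1) FNil
    (FCons (FIf (FVar 3) (FVar 3) (FVar 4)) (FVar 2))
    (fun s1 acc => acc = encode_seq
      (rev [seq encode_bool (r \in S :|: T) | r <- s1])) 5 (enum R).
- by [].
- by left.
- by [].
- by rewrite map_rcons rev_rcons /= !inE !truth_encode; case: (x \in S).
have [hr hrc] := rev_spec (rev [seq encode_bool (r \in S :|: T) | r <- enum R]).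
rewrite revK -hv in hr hrc.
split; first exact: hr.
by move: hc hrc; rewrite size_rev size_map size_enum /=; lia.
Qed.
#[global] Opaque union_p.

Definition row (X : finType) (A : {set X * R}) (x : X) : {set R} :=
  [set r | (x, r) \in A].

Lemma encode_relationE (X : finType) (A : {set X * R}) :
  encode_relation A = encode_seq [seq encode_set (row A x) | x <- enum X].
Proof.
congr encode_seq; apply: eq_map => x; congr encode_seq; apply: eq_map => r.
by rewrite inE.
Qed.

(** A constraint with two equal components bars its resource from every independent set, in
    agreement with [satisfies]. *)
Definition independent (C : {set R * R}) S :=
  [forall c in C, ~~ ((c.1 \in S) && (c.2 \in S))].

Lemma independent_spec (C : {set R * R}) S :
  feval [:: encode_relation C; encode_set S] independent_p =
    encode_bool (independent C S) /\
  fcost [:: encode_relation C; encode_set S] independent_p <=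
    20 * ((dim R).+1 * (dim R).+1).
Proof.
have [|||r1 r r2 acc _ ->|-> hc] := @fold2_spec _
    (fun r => encode_set (row C r)) (fun r => encode_bool (r \in S))
    [:: encode_relation C; encode_set S] (FVar 0) (FVar 1) FTrue
    (FIf (FVar 4) (FIf (FCall [:: 3; 1] disjoint_p) (FVar 2) FNil) (FVar 2))
    (fun rs acc => acc =
      encode_bool (all (fun r => (r \in S) ==> [disjoint row C r & S]) rs))
    (5 + 10 * (dim R).+1) (enum R).
- exact: encode_relationE.
- by left.
- by [].
- have [dis_v dis_c] := disjoint_spec (row C r) S.
  rewrite all_rcons /= !truth_encode dis_v truth_encode.
  by case: (r \in S); case: [disjoint _ & _]; split=> //=; lia.
- split; last by apply: leq_trans hc _; rewrite /= size_enum; nia.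
  congr encode_bool; apply/allP/forall_inP => /= h.
    move=> [r r'] Crr' /=; apply/negP => /andP [rS r'S].
    move: (h r (mem_enum _ _)); rewrite rS /= disjoint_subset => /subsetP.
    by move=> /(_ r'); rewrite !inE Crr' => /(_ isT) /negP.
  move=> r _; apply/implyP => rS; rewrite disjoint_subset; apply/subsetP => r'.
  by rewrite !inE => /h /=; rewrite rS.
Qed.
#[global] Opaque independent_p.

Definition double (vs : seq bitseq) :=
  foldl (fun a v => (true :: v) :: (false :: v) :: a) [::] vs.

Lemma double_rcons vs v :
  double (rcons vs v) = (true :: v) :: (false :: v) :: double vs.
Proof. by rewrite /double foldl_rcons. Qed.

Lemma size_double vs : size (double vs) = 2 * size vs.
Proof.
by elim/last_ind: vs => // vs v IH; rewrite double_rcons /= IH size_rcons; lia.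
Qed.

Lemma mem_double vs b v : (b :: v \in double vs) = (v \in vs).
Proof.
elim/last_ind: vs => // vs w IH; rewrite double_rcons !inE IH mem_rcons inE.
by rewrite !eqseq_cons orbA; congr (_ || _); case: (b); rewrite ?orbF.
Qed.

Definition encode_bitseq (v : bitseq) := encode_seq [seq encode_bool b | b <- v].

Lemma subsets_spec (C : {set R * R}) :
  exists2 Ss : seq {set R},
    [/\ feval [:: encode_relation C] subsets_p =
         encode_seq [seq encode_set X | X <- Ss],
     size Ss = 2 ^ dim R & forall S, S \in Ss] &
    fcost [:: encode_relation C] subsets_p <= 20 * ((dim R).+1 * 2 ^ dim R).
Proof.
(* Before the last round the strings are shorter than a full bit vector, so the invariant speaks of
   bit strings instead of sets. *)
have [||||] := @fold2_spec _
    (fun r => encode_set (row C r)) (fun=> Leaf)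
    [:: encode_relation C] (FVar 0) FNil (FCons FNil FNil)
    (FFold (FVar 1) FNil FNil
       (FCons (FCons FTrue (FVar 5)) (FCons (FCons FNil (FVar 5)) (FVar 4))))
    (fun rs acc => exists2 vs : seq bitseq,
       acc = encode_seq [seq encode_bitseq v | v <- vs] &
       [/\ size vs = 2 ^ size rs, all (fun v => size v == size rs) vs &
        forall v : bitseq, size v = size rs -> v \in vs])
    (12 * 2 ^ dim R) (enum R).
- exact: encode_relationE.
- by right.
- by exists [:: [::]] => //; split=> // v /size0nil ->.
- move=> r1 r r2 acc er [vs -> [sz_vs /allP sz_v all_v]].
  have [||||-> hc] := @fold2_spec _ encode_bitseq (fun=> Leaf)
    [:: encode_relation C; encode_seq [seq encode_bitseq v | v <- vs];
        encode_set (row C r); Leaf] (FVar 1) FNil FNil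
    (FCons (FCons FTrue (FVar 5)) (FCons (FCons FNil (FVar 5)) (FVar 4)))
    (fun ws acc => acc = encode_seq [seq encode_bitseq v | v <- double ws]) 11 vs.
  + by [].
  + by right.
  + by [].
  + by move=> ws w ws' acc' _ ->; rewrite double_rcons.
  have lt_r1 : size r1 < dim R by rewrite -size_enum er size_cat /=; lia.
  split; last first.
    apply: leq_trans hc _; rewrite /= sz_vs.
    have : 2 ^ (size r1).+1 <= 2 ^ dim R by rewrite leq_exp2l.
    have : 0 < 2 ^ size r1 by rewrite expn_gt0.
    by rewrite expnS; move: (2 ^ size r1) (2 ^ dim R) => a b; lia.
  exists (double vs) => //; split.
  + by rewrite size_double sz_vs size_rcons expnS.
  + have : all (fun v => size v == (size r1).+1) (double vs).
      elim/last_ind: vs sz_v {sz_vs all_v hc} => // vs v IH sz_v.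
      rewrite double_rcons /= !eqSS sz_v ?mem_rcons ?mem_head //=.
      by apply: IH => w wvs; apply: sz_v; rewrite mem_rcons inE wvs orbT.
    by rewrite size_rcons.
  + move=> [|b v]; rewrite size_rcons // => -[sz]; rewrite mem_double.
    exact: all_v.
move=> [vs -> [sz_vs /allP sz_v all_v]] hc.
(* Bit [i] of a full string decides the membership of the resource at position [i] of [enum R]. *)
pose set_of (v : bitseq) := [set r | nth false v (index r (enum R))].
exists [seq set_of v | v <- vs]; last first.
  apply: leq_trans hc _; rewrite /= size_enum.
  have : 0 < 2 ^ dim R by rewrite expn_gt0.
  by nia.
split; last 1 first.
- move=> S; apply/mapP; exists [seq r \in S | r <- enum R].
    by apply: all_v; rewrite size_map.
  apply/setP => r; rewrite inE (nth_map r) ?nth_index ?mem_enum //.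
  by rewrite index_mem mem_enum.
- congr encode_seq; rewrite -map_comp; apply/eq_in_map => v /sz_v /eqP sz /=.
  rewrite /encode_set /encode_bitseq; congr encode_seq.
  rewrite (map_comp encode_bool (mem (set_of v))); congr map.
  apply: (@eq_from_nth _ false) => [|i lt_i]; first by rewrite size_map.
  rewrite sz in lt_i; have [r0 _] : exists r0, r0 \in enum R.
    by case: (enum R) lt_i => // r0 s _; exists r0; exact: mem_head.
  by rewrite (nth_map r0) //= inE index_uniq ?enum_uniq.
- by rewrite size_map sz_vs size_enum.
Qed.
#[global] Opaque subsets_p.

Lemma independents_spec (C : {set R * R}) (Ss : seq {set R}) :
  exists2 Is : seq {set R},
    [/\ feval [:: encode_relation C; encode_seq [seq encode_set X | X <- Ss]]
           independents_p = encode_seq [seq encode_set X | X <- Is],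
     size Is <= size Ss & forall S, (S \in Is) = independent C S && (S \in Ss)] &
    fcost [:: encode_relation C; encode_seq [seq encode_set X | X <- Ss]]
      independents_p <= 30 * ((dim R).+1 * (dim R).+1 * (size Ss).+1).
Proof.
exists (rev (filter (independent C) Ss)); last first.
  have [|||ds S es acc _ _|_ hc] := @fold2_spec _ encode_set (fun=> Leaf)
    [:: encode_relation C; encode_seq [seq encode_set X | X <- Ss]]
    (FVar 1) FNil FNil
    (FIf (FCall [:: 0; 3] independent_p) (FCons (FVar 3) (FVar 2)) (FVar 2))
    (fun _ _ => True) (4 + 20 * ((dim R).+1 * (dim R).+1)) Ss.
  - by [].
  - by right.
  - by [].
  - have [_ ind_c] := independent_spec C S.
    by rewrite /=; split=> //; case: ifP => _; lia.
  - by apply: leq_trans hc _; rewrite /=; nia.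
split.
- have [|||ds S es acc _ ->|-> //] := @fold2_spec _ encode_set (fun=> Leaf)
    [:: encode_relation C; encode_seq [seq encode_set X | X <- Ss]]
    (FVar 1) FNil FNil
    (FIf (FCall [:: 0; 3] independent_p) (FCons (FVar 3) (FVar 2)) (FVar 2))
    (fun ds acc => acc = encode_seq [seq encode_set X |
       X <- rev (filter (independent C) ds)]) (4 + 20 * ((dim R).+1 * (dim R).+1)) Ss.
  - by [].
  - by right.
  - by [].
  - have [ind_v ind_c] := independent_spec C S.
    rewrite filter_rcons /= ind_v truth_encode.
    by case: (independent C S); rewrite ?rev_rcons; split=> //; lia.
- by rewrite size_rev size_filter count_size.
- by move=> S; rewrite mem_rev mem_filter.
Qed.
#[global] Opaque independents_p.

(** Unary, since the machine has only trees; [good_value] keeps the values of plans polynomial. *)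
Definition encode_nat n := encode_seq (nseq n Leaf).

Lemma truth_nat n : truth (encode_nat n) = (0 < n).
Proof. by case: n. Qed.

Lemma lt_spec a b :
  feval [:: encode_nat a; encode_nat b] lt_p = encode_nat (b - a) /\
  fcost [:: encode_nat a; encode_nat b] lt_p <= 4 * a.+1.
Proof.
have [|||s1 x s2 acc _ ->|-> hc] := @fold2_spec unit (fun=> Leaf) (fun=> Leaf)
    [:: encode_nat a; encode_nat b] (FVar 0) FNil (FVar 1) (FTl (FVar 2))
    (fun s acc => acc = encode_nat (b - size s)) 2 (nseq a tt).
- by rewrite map_nseq.
- by right.
- by rewrite subn0.
- by rewrite size_rcons subnS; split=> //=; case: (b - size s1).
- by rewrite size_nseq; split=> //; apply: leq_trans hc _; rewrite size_nseq /=; lia.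
Qed.
#[global] Opaque lt_p.

Lemma count_spec S n :
  feval [:: encode_set S; encode_nat n] count_p = encode_nat (#|S| + n) /\
  fcost [:: encode_set S; encode_nat n] count_p <= 10 * (dim R).+1.
Proof.
have [|||s1 r s2 acc _ ->|-> hc] := @fold2_spec _
    (fun r => encode_bool (r \in S)) (fun=> Leaf)
    [:: encode_set S; encode_nat n] (FVar 0) FNil (FVar 1)
    (FIf (FVar 3) (FCons FNil (FVar 2)) (FVar 2))
    (fun s acc => acc = encode_nat (count (mem S) s + n)) 5 (enum R).
- by [].
- by right.
- by [].
- rewrite -cats1 count_cat /= truth_encode addn0 addnAC.
  by case: (r \in S); rewrite ?addn1 ?addn0.
- split; last by apply: leq_trans hc _; rewrite /= size_enum; lia.
  by rewrite -size_filter [in RHS]cardE enumT.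
Qed.
#[global] Opaque count_p.

Lemma const_spec (C : {set R * R}) v :
  feval [:: encode_relation C; v] const_p = encode_seq [seq v | r <- enum R] /\
  fcost [:: encode_relation C; v] const_p <= 10 * (dim R).+1.
Proof.
have [|||s1 r s2 acc _ ->|-> hc] := @fold2_spec _
    (fun r => encode_set (row C r)) (fun=> Leaf)
    [:: encode_relation C; v] (FVar 0) FNil FNil (FCons (FVar 1) (FVar 2))
    (fun s acc => acc = encode_seq [seq v | r <- s]) 3 (enum R).
- exact: encode_relationE.
- by right.
- by [].
- split=> //=; rewrite -[Node _ _]/(encode_seq (v :: [seq v | _ <- s1])).
  by congr encode_seq; elim: s1 => //= a s <-.
- by split=> //; apply: leq_trans hc _; rewrite /= size_enum; lia.
Qed.
#[global] Opaque const_p.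

End Sets.

(** * Correctness and cost of the dynamic program *)

Section Plans.

Variables (U R : finType) (B : {set U * R}) (C : {set R * R}).
Implicit Types (u : U) (us : seq U) (S T : {set R}).

(* The first component is one more than the number of authorizations granted. *)
Definition plan := (nat * {ffun U -> {set R}})%type.

(** Only the values at the users seen so far are stored. The total function lets the proofs treat an
    extension as a change at one point. *)
Definition encode_plan us (p : plan) :=
  Node (encode_nat p.1) (encode_seq [seq encode_set (p.2 u) | u <- us]).

Definition encode_best us (o : option plan) :=
  if o is Some p then encode_plan us p else Leaf.

Definition encode_entry us (e : {set R} * plan) :=
  Node (encode_set e.1) (encode_plan us e.2).

Definition value (o : option plan) := if o is Some p then p.1 else 0.

Definition better (o : option plan) (p : plan) :=
  if value o < p.1 then Some p else o.

Lemma value_better o p : value (better o p) = maxn (value o) p.1.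
Proof. by rewrite /better /maxn; case: ifP. Qed.

(** The comparison runs along the unary value of [o], so this alone enters the cost. *)
Lemma better_spec us o p :
  feval [:: encode_best us o; encode_plan us p] better_p =
    encode_best us (better o p) /\
  fcost [:: encode_best us o; encode_plan us p] better_p <= 20 * (value o).+1.
Proof.
have hd_best : hd (encode_best us o) = encode_nat (value o) by case: o.
have [lt_v lt_c] := lt_spec (value o) p.1.
rewrite /better_p /= !hd_best lt_v truth_nat subn_gt0 /better.
by split; [case: ifP | move: lt_c; case: ifP => _; lia].
Qed.
#[global] Opaque better_p.

Definition extend u T (e : {set R} * plan) S o :=
  if (S \subset row B u) && (T \subset S :|: e.1) then
    better o (#|S| + e.2.1, [ffun v => if v == u then S else e.2.2 v])
  else o.

Lemma extend_spec m u us T e S o :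
  dim R < m -> value o <= m -> u \notin us ->
  feval [:: encode_set T; encode_set (row B u); encode_entry us e; encode_set S;
            encode_best (u :: us) o] extend_p =
    encode_best (u :: us) (extend u T e S o) /\
  fcost [:: encode_set T; encode_set (row B u); encode_entry us e; encode_set S;
            encode_best (u :: us) o] extend_p <= 200 * m.
Proof.
move=> lt_m le_v us'u.
have [sub_v sub_c] := subset_spec S (row B u).
have [un_v un_c] := union_spec S e.1.
have [sub'_v sub'_c] := subset_spec T (S :|: e.1).
have [co_v co_c] := count_spec S e.2.1.
pose p : plan := (#|S| + e.2.1, [ffun v => if v == u then S else e.2.2 v]).
have [be_v be_c] := better_spec (u :: us) o p.
(* As [u] is not in [us], changing the function at [u] keeps the stored sets, and the new list is
   the old one with the set of [S] in front. *)
have ep : Node (encode_nat (#|S| + e.2.1)) (Node (encode_set S)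
    (encode_seq [seq encode_set (e.2.2 u) | u <- us])) = encode_plan (u :: us) p.
  congr (Node _ (Node _ _)); first by rewrite ffunE eqxx.
  congr encode_seq; apply/eq_in_map => v v_us; rewrite ffunE.
  by case: eqP v_us us'u => // -> ->.
rewrite /extend_p /= /extend sub_v truth_encode.
case: (S \subset _) => /=; last by split=> //; lia.
rewrite un_v sub'_v truth_encode.
case: (T \subset _) => /=; last by split=> //; lia.
by rewrite co_v ep; split; [exact: be_v | lia].
Qed.
#[global] Opaque extend_p.

(** Authorization and eligibility, as conditions on the resources of a single user. *)
Definition admissible u S := (S \subset row B u) && independent C S.

(* The plan of an entry covers at least its key, rather than exactly. *)
Definition good us (e : {set R} * plan) :=
  [&& all (fun u => admissible u (e.2.2 u)) us,
      e.1 \subset \bigcup_(u <- us) e.2.2 u &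
      e.2.1 == (\sum_(u <- us) #|e.2.2 u|).+1].

Definition good_best us T (o : option plan) :=
  if o is Some p then good us (T, p) else true.

(** Each user receives at most [dim R] resources; the successor is the offset of plan values. *)
Lemma good_value us T o :
  good_best us T o -> value o <= (size us * dim R).+1.
Proof.
case: o => //= p /and3P [_ _ /eqP /= ->]; rewrite ltnS.
elim: us => [|u us IH]; first by rewrite big_nil.
by rewrite big_cons mulSn leq_add //; exact: max_card.
Qed.

Lemma extend_good u us T e S o :
  u \notin us -> good us e -> independent C S -> good_best (u :: us) T o ->
  good_best (u :: us) T (extend u T e S o).
Proof.
move=> us'u /and3P [ge /subsetP se /eqP ve] iS go; rewrite /extend.
case: ifP => // /andP [sS /subsetP sT]; rewrite /better; case: ifP => // _.
have eqf v : v \in us -> (if v == u then S else e.2.2 v) = e.2.2 v.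
  by case: eqP us'u => // -> /negbTE ->.
apply/and3P; split=> /=.
- rewrite ffunE eqxx /admissible sS iS /=.
  by apply/allP => v v_us; rewrite ffunE eqf //; exact: (allP ge).
- have -> : \bigcup_(v <- u :: us)
      [ffun v => if v == u then S else e.2.2 v] v =
      S :|: \bigcup_(v <- us) e.2.2 v.
    rewrite big_cons ffunE eqxx; congr (_ :|: _).
    by apply: eq_big_seq => v v_us; rewrite ffunE eqf.
  by apply/subsetP => r /sT; rewrite !inE => /orP [->//|/se ->]; rewrite orbT.
- rewrite big_cons ffunE eqxx ve addnS eqSS eqn_add2l; apply/eqP.
  by apply: eq_big_seq => v v_us; rewrite ffunE eqf.
Qed.

Lemma extend_value u T e S o :
  value o <= value (extend u T e S o) /\
  (S \subset row B u -> T \subset S :|: e.1 ->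
     #|S| + e.2.1 <= value (extend u T e S o)).
Proof.
rewrite /extend; case: ifP => [_|h]; last by split=> // h1 h2; rewrite h1 h2 in h.
by rewrite value_better /= leq_maxl leq_maxr.
Qed.

Lemma best_spec m u us T L (Is : seq {set R}) :
  dim R < m -> (size us).+1 * dim R < m -> u \notin us -> all (good us) L ->
  all (independent C) Is ->
  let env := [:: encode_set T; encode_set (row B u);
                 encode_seq [seq encode_entry us e | e <- L];
                 encode_seq [seq encode_set X | X <- Is]] in
  exists o, [/\ feval env best_p = encode_best (u :: us) o,
    good_best (u :: us) T o,
    forall e S, e \in L -> S \in Is -> S \subset row B u ->
      T \subset S :|: e.1 -> #|S| + e.2.1 <= value o &
    fcost env best_p <= 300 * (m * ((size L).+1 * (size Is).+1))].
Proof.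
move=> lt_m le_m us'u /allP good_L /allP ind_Is env.
have m_gt0 : 0 < m by lia.
have [||||[o [ov og ob]] hc] := @fold2_spec _ (encode_entry us) (fun=> Leaf)
    env (FVar 2) FNil FNil
    (FFold (FVar 3) FNil (FVar 4) (FCall [:: 0; 1; 5; 8; 7] extend_p))
    (fun es acc => exists o, [/\ acc = encode_best (u :: us) o,
       good_best (u :: us) T o &
       forall e S, e \in es -> S \in Is -> S \subset row B u ->
         T \subset S :|: e.1 -> #|S| + e.2.1 <= value o])
    (4 + size Is * (200 * m).+1) L.
- by [].
- by right.
- by exists None.
- move=> es e es' _ eL [o [-> og ob]].
  (* The inner invariant records that the value has not dropped below that of [o], so the bounds for
     earlier entries persist. *)
  have [||||] := @fold2_spec _ (@encode_set R) (fun=> Leaf)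
      (env ++ [:: encode_best (u :: us) o; encode_entry us e; Leaf])
      (FVar 3) FNil (FVar 4) (FCall [:: 0; 1; 5; 8; 7] extend_p)
      (fun Ss acc => exists o', [/\ acc = encode_best (u :: us) o',
         good_best (u :: us) T o', value o <= value o' &
         forall S, S \in Ss -> S \subset row B u ->
           T \subset S :|: e.1 -> #|S| + e.2.1 <= value o'])
      (200 * m) Is.
  + by [].
  + by right.
  + by exists o.
  + move=> Ss S Ss' _ eIs [o' [-> og' le_o ob']].
    have Se : good us e by apply: good_L; rewrite eL mem_cat mem_head orbT.
    have SS : independent C S by apply: ind_Is; rewrite eIs mem_cat mem_head orbT.
    have le_v : value o' <= m.
      by apply: leq_trans (good_value og') _; rewrite /=; lia.
    have [ex_v ex_c] := extend_spec T e S lt_m le_v us'u.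
    have [ex1 ex2] := extend_value u T e S o'.
    split; last exact: ex_c.
    exists (extend u T e S o'); split.
    * exact: ex_v.
    * exact: extend_good.
    * exact: leq_trans ex1.
    * move=> S'; rewrite mem_rcons inE => /orP [/eqP ->//|S'in sS' sT].
      by apply: leq_trans ex1; apply: ob'.
  move=> [o' [-> og' le_o ob']] hc; split; last first.
    by apply: leq_trans hc _; rewrite /=; lia.
  exists o'; split=> // e' S; rewrite mem_rcons inE => /orP [/eqP ->|e'in].
    exact: ob'.
  by move=> h1 h2 h3; apply: leq_trans le_o; apply: ob.
exists o; split=> //; apply: leq_trans hc _; rewrite /=.
by move: (size L) (size Is) => a b; nia.
Qed.
#[global] Opaque best_p.

(** Optimality of the table at [T], against all admissible assignments that cover at least [T]. If
    there are none, no entry is demanded. *)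
Definition dominates us T (L : seq ({set R} * plan)) :=
  forall g : U -> {set R}, all (fun u => admissible u (g u)) us ->
  T \subset \bigcup_(u <- us) g u ->
  exists2 e, e \in L & e.1 = T /\ (\sum_(u <- us) #|g u|).+1 <= e.2.1.

Definition table us L := all (good us) L /\ forall T, dominates us T L.

Lemma step_spec m u us L (Is Ss : seq {set R}) :
  dim R < m -> (size us).+1 * dim R < m -> u \notin us -> table us L ->
  (forall S, (S \in Is) = independent C S) -> (forall S, S \in Ss) ->
  let env := [:: encode_set (row B u);
                 encode_seq [seq encode_entry us e | e <- L];
                 encode_seq [seq encode_set X | X <- Is];
                 encode_seq [seq encode_set X | X <- Ss]] in
  exists L', [/\ feval env step_p =
      encode_seq [seq encode_entry (u :: us) e | e <- L'],
    table (u :: us) L', size L' <= size Ss &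
    fcost env step_p <=
      400 * (m * ((size L).+1 * (size Is).+1 * (size Ss).+1))].
Proof.
move=> lt_m le_m us'u [good_L dom_L] Is_ind Ss_all env.
have m_gt0 : 0 < m by lia.
have ind_Is : all (independent C) Is by apply/allP => S; rewrite Is_ind.
have [||||[L' [-> good_L' sz_L' dom_L']] hc] := @fold2_spec _ (@encode_set R)
    (fun=> Leaf) env (FVar 3) FNil FNil
    (FLet (FCall [:: 5; 0; 1; 2] best_p)
      (FIf (FVar 7) (FCons (FCons (FVar 5) (FVar 7)) (FVar 4)) (FVar 4)))
    (fun Ts acc => exists L', [/\
       acc = encode_seq [seq encode_entry (u :: us) e | e <- L'],
       all (good (u :: us)) L', size L' <= size Ts &
       forall T, T \in Ts -> dominates (u :: us) T L'])
    (8 + 300 * (m * ((size L).+1 * (size Is).+1))) Ss.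
- by [].
- by right.
- by exists [::].
- move=> Ts T Ts' _ _ [L' [-> good_L' sz_L' dom_L']].
  have [o [ov og ob oc]] := best_spec T lt_m le_m us'u good_L ind_Is.
  split; last first.
    rewrite /= in oc *; move: oc; case: ifP => _; lia.
  exists (if o is Some p then (T, p) :: L' else L'); split.
  + by rewrite /= ov; case: o {ov og ob}.
  + by case: o og {ov ob} => //= p ->.
  + by rewrite size_rcons; case: o {ov og ob} => //=; lia.
  + move=> T'; rewrite mem_rcons inE => /orP [/eqP -> g|T'in g adm sub].
      move=> /= /andP [adm_u adm]; rewrite !big_cons => sub.
      (* The old table is consulted at the exact union of the sets that [g] gives to the earlier
         users; with [g u] this union covers the target. *)
      have [e eL [e1 e2]] := dom_L _ g adm (subxx _).
      have le_o : #|g u| + e.2.1 <= value o.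
        case/andP: adm_u => sub_u ind_u; apply: ob => //; first by rewrite Is_ind.
        by rewrite e1.
      (* A plan was found: the candidate has positive value, and a missing plan has value 0. *)
      case: o ov og ob le_o => [p|] ov og ob /= le_o.
        2: by have := leq_trans e2 (leq_trans (leq_addl _ _) le_o).
      by exists (T, p); [exact: mem_head |]; split=> //=; rewrite -addnS;
        apply: leq_trans le_o; rewrite leq_add2l.
    have [e eL' eT] := dom_L' _ T'in g adm sub.
    by exists e => //; case: o {ov og ob} => // p; rewrite inE eL' orbT.
exists L'; split=> //.
  by split=> // T; apply: dom_L'.
apply: leq_trans hc _; rewrite /=.
by move: (size L) (size Is) (size Ss) => a b c; nia.
Qed.
#[global] Opaque step_p.

Lemma loop_spec m us (Is Ss : seq {set R}) :
  dim R < m -> size us * dim R < m -> uniq us ->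
  (forall S, (S \in Is) = independent C S) -> (forall S, S \in Ss) ->
  size Is <= size Ss ->
  let env := [:: encode_seq [seq encode_set (row B u) | u <- us];
                 encode_seq
                   [:: encode_entry [::] (set0, (1, [ffun => set0]))];
                 encode_seq [seq encode_set X | X <- Is];
                 encode_seq [seq encode_set X | X <- Ss]] in
  exists L, [/\ feval env loop_p =
      encode_seq [seq encode_entry (rev us) e | e <- L],
    table (rev us) L, size L <= size Ss &
    fcost env loop_p <= 500 * ((size us).+1 * (m * (size Ss).+1 ^ 3))].
Proof.
move=> lt_m le_m uniq_us Is_ind Ss_all le_Is env.
(* Makes the size bound hold for the initial table, which has one entry. *)
have Ss_gt0 : 0 < size Ss by have := Ss_all set0; case: (Ss).
have [||||[L [-> tab_L sz_L]] hc] := @fold2_spec _ (fun u => encode_set (row B u))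
    (fun=> Leaf) env (FVar 0) FNil (FVar 1) (FCall [:: 5; 4; 2; 3] step_p)
    (fun vs acc => exists L, [/\
       acc = encode_seq [seq encode_entry (rev vs) e | e <- L],
       table (rev vs) L & size L <= size Ss])
    (400 * (m * (size Ss).+1 ^ 3)) us.
- by [].
- by right.
(* Without users only the empty set is covered, with no authorization granted. *)
- exists [:: (set0, (1, [ffun => set0]))]; split=> //; split=> [|T g _] /=.
    by rewrite /good /= !big_nil sub0set.
  rewrite !big_nil subset0 => /eqP ->.
  by exists (set0, (1, [ffun => set0])); first exact: mem_head.
- move=> vs u vs' _ us_eq [L [-> tab_L sz_L]].
  have vs'u : u \notin rev vs.
    move: uniq_us; rewrite us_eq cat_uniq => /and3P [_ /hasPn /(_ u)].
    by rewrite mem_rev mem_head => /(_ isT).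
  have le_vs : (size (rev vs)).+1 * dim R < m.
    apply: leq_ltn_trans le_m; rewrite leq_mul2r us_eq size_cat size_rev /=.
    by apply/orP; right; lia.
  have [L' [sv st sz sc]] := step_spec lt_m le_vs vs'u tab_L Is_ind Ss_all.
  split; first by exists L'; rewrite rev_rcons; split.
  (* Old entries, independent sets and targets each number at most [size Ss], hence the cube, which
     becomes [8 ^ dim R] up to a constant. *)
  apply: leq_trans sc _; rewrite !leq_mul2l /= -mulnA !expnS expn0 muln1.
  by rewrite !leq_mul // orbT.
exists L; split=> //; apply: leq_trans hc _; rewrite /=.
have : 0 < m * (size Ss).+1 ^ 3 by rewrite muln_gt0 expn_gt0 /=; lia.
by move: (m * _) (size us) => a b; nia.
Qed.
#[global] Opaque loop_p.

Lemma final_spec m us L :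
  dim R < m -> size us * dim R < m -> all (good us) L ->
  let env := [:: encode_set [set: R]; encode_seq [seq encode_entry us e | e <- L]] in
  exists o, [/\ feval env final_p = encode_best us o, good_best us setT o,
    forall e, e \in L -> e.1 = setT -> e.2.1 <= value o &
    fcost env final_p <= 100 * (m * (size L).+1)].
Proof.
move=> lt_m le_m /allP good_L env.
have [||||[o [-> og ob]] hc] := @fold2_spec _ (encode_entry us) (fun=> Leaf)
    env (FVar 1) FNil FNil
    (FLet (FHd (FVar 3))
      (FIf (FCall [:: 0; 5] subset_p)
        (FLet (FTl (FVar 3)) (FCall [:: 2; 6] better_p))
        (FVar 2)))
    (fun es acc => exists o, [/\ acc = encode_best us o,
       good_best us setT o & forall e, e \in es -> e.1 = setT -> e.2.1 <= value o])
    (60 * m) L.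
- by [].
- by right.
- by exists None.
- move=> es e es' _ eL [o [-> og ob]].
  have ge : good us e by apply: good_L; rewrite eL mem_cat mem_head orbT.
  have le_o : value o <= m by apply: leq_trans (good_value og) _; lia.
  have [sub_v sub_c] := subset_spec [set: R] e.1.
  have [be_v be_c] := better_spec us o e.2.
  split; last first.
    rewrite /= sub_v truth_encode; case: ifP => _; last by lia.
    by lia.
  rewrite /= sub_v truth_encode subTset; have [eT|neT] := eqVneq e.1 setT.
    exists (better o e.2); split; first exact: be_v.
      by rewrite /better; case: ifP => //= _; rewrite -eT -surjective_pairing.
    move=> e'; rewrite value_better mem_rcons inE => /orP [/eqP -> _|h1 h2].
      exact: leq_maxr.
    by apply: leq_trans (leq_maxl _ _); apply: ob.
  exists o; split=> // e'; rewrite mem_rcons inE => /orP [/eqP ->|]; last exact: ob.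
  by move=> eT; rewrite eT eqxx in neT.
by exists o; split=> //; apply: leq_trans hc _; rewrite /=; nia.
Qed.
#[global] Opaque final_p.

End Plans.

(** * From plans back to authorization relations *)

Section Authorizations.

Variable I : instance.
Local Notation U := (user I).
Local Notation R := (resource I).
Implicit Types A : authorization I.

(** A constraint is violated iff some user holds both of its resources, so eligibility, like
    authorization, can be checked row by row. Completeness says that the rows cover all
    resources. *)
Lemma validP A :
  reflect
    ((forall u, admissible (base I) (constraints I) u (row A u)) /\
     [set: R] \subset \bigcup_(u <- enum U) row A u)
    (valid A).
Proof.
rewrite big_enum subTset; apply: (iffP and3P) => [[autA cplA eliA]|[admA covA]].
  split=> [u|].
    apply/andP; split.
      by apply/subsetP => r; rewrite !inE => /(subsetP autA).
    apply/forall_inP => /= -[r r'] Crr' /=; rewrite !inE; apply/negP => /andP [ur ur'].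
    have /eqP/setP/(_ u) := forall_inP eliA _ Crr'.
    by rewrite !inE /= ur ur'.
  apply/eqP/setP => r; rewrite inE.
  have /set0Pn [u] := forallP cplA r; rewrite inE => ur.
  by apply/bigcupP; exists u => //; rewrite inE.
split.
- apply/subsetP => -[u r] ur; have /andP [/subsetP /(_ r)] := admA u.
  by rewrite !inE => /(_ ur).
- apply/forallP => r; apply/set0Pn.
  have : r \in [set: R] by rewrite inE.
  by rewrite -(eqP covA) => /bigcupP [u _]; rewrite inE => ur; exists u; rewrite inE.
- apply/forall_inP => -[r r'] Crr'; apply/eqP/setP => u; rewrite !inE /=.
  have /andP [_ /forall_inP /(_ _ Crr')] := admA u.
  by rewrite !inE /= => /negbTE.
Qed.

Lemma card_rows A : #|A| = \sum_(u <- enum U) #|row A u|.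
Proof.
rewrite big_enum -sum1_card /=.
rewrite (eq_bigr (fun u => \sum_(r | (u, r) \in A) 1)); last first.
  by move=> u _; rewrite -sum1_card; apply: eq_bigl => r; rewrite inE.
by rewrite pair_big_dep; apply: eq_bigl => -[u r].
Qed.

Definition relation_of (f : U -> {set R}) : authorization I :=
  [set p | p.2 \in f p.1].

Lemma row_relation_of f u : row (relation_of f) u = f u.
Proof. by apply/setP => r; rewrite !inE. Qed.

Definition answer_of (o : option (plan U R)) : option (authorization I) :=
  if o is Some p then Some (relation_of p.2) else None.

(** The rows of a valid relation form an admissible cover, so domination at [setT] puts its
    cardinality strictly below the value of [o]. Hence a missing plan excludes valid relations, and
    a plan of value [v] yields a valid one with [v - 1] pairs, the maximum. *)
Lemma answer_of_correct o L :
  table (base I) (constraints I) (enum U) L ->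
  good_best (base I) (constraints I) (enum U) setT o ->
  (forall e, e \in L -> e.1 = setT -> e.2.1 <= value o) ->
  maxAPEP_SoD_U (answer_of o).
Proof.
move=> [_ domL] og ob.
have opt A : valid A -> #|A| < value o.
  move=> /validP [admA covA].
  have [|e eL [e1 e2]] := domL setT (row A) _ covA; first by apply/allP.
  by rewrite card_rows; apply: leq_trans e2 _; apply: ob.
case: o og {ob} opt => [p|] /= og opt; last first.
  by move=> A; apply/negP => /opt.
case/and3P: og => /= /allP adm cov /eqP pv; split=> [|A /opt].
  apply/validP; split=> [u|].
    by rewrite row_relation_of; apply: adm; rewrite mem_enum.
  by under eq_bigr do rewrite row_relation_of.
rewrite pv ltnS (card_rows (relation_of _)).
by under [X in _ -> _ <= X]eq_bigr do rewrite row_relation_of.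
Qed.

Lemma size_encode_seq (X : Type) (f : X -> tree) c s :
  (forall x, c <= tree_size (f x)) ->
  size s * c.+1 < tree_size (encode_seq [seq f x | x <- s]).
Proof.
by move=> le_c; elim: s => //= x s IH; have := le_c x; rewrite mulSn; lia.
Qed.

Lemma tree_size_gt0 v : 0 < tree_size v.
Proof. by case: v. Qed.

Lemma size_encode_set (T : finType) (S : {set T}) :
  dim T < tree_size (encode_set S).
Proof.
have := @size_encode_seq _ (fun r => encode_bool (r \in S)) 0 (enum T).
by rewrite muln1 size_enum; apply.
Qed.

(** The constraint matrix has [dim R] rows, which bounds [dim R]; the base matrix has [dim U] rows
    of more than [dim R] nodes each, which gives the other two bounds. *)
Lemma input_size_bound :
  [/\ (dim R).+1 <= input_size I, (dim U).+1 <= input_size I &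
      dim U * dim R < input_size I].
Proof.
rewrite /input_size /encode_instance !encode_relationE /=.
have := @size_encode_seq _ (fun u => encode_set (row (base I) u)) (dim R) (enum U)
  (fun u => ltnW (size_encode_set _)).
have := @size_encode_seq _ (fun u => encode_set (row (constraints I) u)) 0 (enum R)
  (fun u => isT).
rewrite !size_enum; move: (tree_size _) (tree_size _) (dim U) (dim R) => a b c d.
by split; nia.
Qed.

Lemma main_spec :
  exists o : option (authorization I), [/\
    feval [:: encode_instance I] main_p = encode_answer o,
    maxAPEP_SoD_U o &
    fcost [:: encode_instance I] main_p <=
      50 * 100 * (input_size I ^ 2 * 8 ^ dim R)].
Proof.
have [le_R le_U le_UR] := input_size_bound; set m := input_size I in le_R le_U le_UR *.
have [Ss [Ss_v sz_Ss Ss_all] Ss_c] := subsets_spec (constraints I).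
have [Is [Is_v sz_Is Is_mem] Is_c] := independents_spec (constraints I) Ss.
have Is_ind S : (S \in Is) = independent (constraints I) S.
  by rewrite Is_mem Ss_all andbT.
have [z_v z_c] := const_spec (constraints I) Leaf.
have [o_v o_c] := const_spec (constraints I) (Node Leaf Leaf).
have zE : encode_seq [seq Leaf | r <- enum R] = encode_set (set0 : {set R}).
  by congr encode_seq; apply: eq_map => r; rewrite inE.
have oE : encode_seq [seq Node Leaf Leaf | r <- enum R] = encode_set [set: R].
  by congr encode_seq; apply: eq_map => r; rewrite inE.
have [r_v r_c] := rev_spec [seq encode_set (row (base I) u) | u <- enum U].
have le_UR' : size (rev (enum U)) * dim R < m by rewrite size_rev size_enum.
have uniqU : uniq (rev (enum U)) by rewrite rev_uniq enum_uniq.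
have [L [L_v tab_L sz_L L_c]] :=
  loop_spec (base I) le_R le_UR' uniqU Is_ind Ss_all sz_Is.
rewrite revK in L_v tab_L.
have le_UR'' : size (enum U) * dim R < m by rewrite size_enum.
have [o [f_v f_g f_o f_c]] := final_spec le_R le_UR'' (proj1 tab_L).
exists (answer_of o).
rewrite -encode_relationE in r_v r_c L_v L_c.
rewrite /main_p /encode_instance /= Ss_v Is_v z_v o_v r_v.
have iE : Node (Node (encode_set (set0 : {set R})) (Node (Node Leaf Leaf) Leaf)) Leaf =
    encode_seq [:: encode_entry [::]
      (set0 : {set R}, (1, [ffun => set0] : {ffun U -> {set R}}))] by [].
rewrite zE oE -map_rev iE L_v f_v; split.
- case: o {f_v f_g f_o} => //= p; rewrite encode_relationE; congr (Node (encode_seq _) _).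
  by apply: eq_map => u; rewrite row_relation_of.
- exact: answer_of_correct tab_L f_g f_o.
- have fin_c : (if truth (encode_best (enum U) o) then (2 + 1).+1 else 1) <= 4.
    by case: ifP.
  have eq8 : 8 ^ dim R = (2 ^ dim R) ^ 3 by rewrite -[8]/(2 ^ 3) -!expnM mulnC.
  have X_gt0 : 0 < 2 ^ dim R by rewrite expn_gt0.
  rewrite sz_Ss in Is_c L_c sz_L; rewrite size_rev !size_enum in L_c.
  rewrite size_map size_enum in r_c; rewrite eq8.
  move: (2 ^ dim R) X_gt0 Ss_c Is_c L_c sz_L => X X_gt0 Ss_c Is_c L_c sz_L.
  have X_le : X <= X ^ 3 by rewrite -{1}[X]expn1 leq_pexp2l.
  (* As [X] is positive, its successor is at most [2 * X]. The loop thus accounts for 4000 of the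
     constant 5000. *)
  have X3_le : X.+1 ^ 3 <= 8 * X ^ 3.
    by rewrite -[8]/(2 ^ 3) -expnMn leq_exp2r //; lia.
  have m_le : m <= m ^ 2 by rewrite -{1}[m]expn1 leq_pexp2l //; lia.
  have h1 : (dim R).+1 * X <= m ^ 2 * X ^ 3.
    by apply: leq_mul => //; apply: leq_trans le_R _.
  have h2 : (dim R).+1 * (dim R).+1 * X.+1 <= m ^ 2 * (2 * X ^ 3).
    by rewrite -mulnn; apply: leq_mul; [apply: leq_mul | lia].
  have h3 : m * 1 <= m ^ 2 * X ^ 3 by apply: leq_mul => //; lia.
  have h4 : m * (size L).+1 <= m ^ 2 * (2 * X ^ 3) by apply: leq_mul => //; lia.
  have h5 : (dim U).+1 * (m * X.+1 ^ 3) <= m * (m * (8 * X ^ 3)).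
    by apply: leq_mul => //; apply: leq_mul.
  rewrite [leqRHS]mulnA mulnn in h5.
  move: Ss_c Is_c z_c o_c r_c L_c f_c fin_c h1 h2 h3 h4 h5.
  rewrite !(mulnCA _ 2) !(mulnCA _ 8).
  move: (m ^ 2 * X ^ 3) => a.
  lia.
Qed.

End Authorizations.

(** * The running time in the claimed form *)

Local Open Scope R_scope.

Lemma INR_expn a b : INR (a ^ b)%N = INR a ^ b.
Proof. by elim: b => // b IH; rewrite expnS mult_INR IH. Qed.

Lemma ln_le x y : 0 < x -> x <= y -> ln x <= ln y.
Proof.
move=> x_gt0 [lt_xy|->]; last exact: Rle_refl.
exact/Rlt_le/ln_increasing.
Qed.

(** For [k >= 4] the logarithm is at least 2, so the exponent on the right is at least [3 * k]. For
    smaller [k] the constant alone suffices, as the other factor is at least 1. *)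
Lemma pow8_le_Rpower k :
  INR (8 ^ k)%N <= INR (8 ^ 4)%N * Rpower 2 (INR k + INR k * log2 (INR k)).
Proof.
have ln2_gt0 : 0 < ln 2 by rewrite -ln_1; apply: ln_increasing; lra.
have k_ge0 := pos_INR k.
have e8 : INR (8 ^ k)%N = Rpower 2 (3 * INR k).
  have -> : 3 = INR 3 by rewrite /=; ring.
  rewrite -Rpower_mult (Rpower_pow 3); last by lra.
  rewrite Rpower_pow ?INR_expn; last by rewrite /=; lra.
  by congr pow; rewrite /=; ring.
have c_ge1 : 1 <= INR (8 ^ 4)%N by apply: (le_INR 1); apply/leP; rewrite expn_gt0.
have [le4|lt4] := leqP 4 k.
  have le4R : 4 <= INR k.
    have -> : 4 = INR 4 by rewrite /=; ring.
    by apply: le_INR; apply/leP.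
  have log_ge2 : 2 <= log2 (INR k).
    have -> : 2 = ln (2 * 2) / ln 2 by rewrite ln_mult; [field | |]; lra.
    rewrite /log2; apply: Rmult_le_compat_r; first exact/Rlt_le/Rinv_0_lt_compat.
    by apply: ln_le; lra.
  rewrite e8; apply: Rle_trans (_ : 1 * Rpower 2 (INR k + INR k * log2 (INR k)) <= _).
    by rewrite Rmult_1_l; apply: Rle_Rpower; [lra | nra].
  by apply: Rmult_le_compat_r => //; exact/Rlt_le/exp_pos.
have le8 : INR (8 ^ k)%N <= INR (8 ^ 4)%N.
  by apply: le_INR; apply/leP; rewrite leq_exp2l // ltnW.
have f_ge1 : 1 <= Rpower 2 (INR k + INR k * log2 (INR k)).
  rewrite -(Rpower_O 2); last by lra.
  apply: Rle_Rpower; first by lra.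
  (* For [k = 0] the factor [INR k] makes the exponent 0, whatever the value of [log2 0]. *)
  case: k k_ge0 {e8 le8 lt4} => [|k] k_ge0; first by rewrite /=; lra.
  have k_ge1 : 1 <= INR k.+1 by apply: (le_INR 1); apply/leP.
  have : 0 <= log2 (INR k.+1).
    rewrite /log2; apply: Rmult_le_pos; last exact/Rlt_le/Rinv_0_lt_compat.
    by rewrite -ln_1; apply: ln_le; lra.
  by move: (log2 _) => l; nra.
by nra.
Qed.

(** The input stays in variable 0 as the whole environment, the compiled program works in the
    registers from 1 on, and a final assignment copies its result to variable 0. *)
Lemma maxAPEP_solved_in_8k :
  exists (p : cmd) (c : nat), forall I : instance,
  exists (o : option (authorization I)) s t,
    [/\ exec p (initial (encode_instance I)) s t, s 0%N = encode_answer o,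
        maxAPEP_SoD_U o & (t <= c * (input_size I ^ 2 * 8 ^ #|resource I|))%N].
Proof.
exists (Seq (compile [:: Var 0] 1 main_p) (Assign 0 (Var 1))).
(* The factor 30 is the overhead of the compilation; the 3 pays for the final copy. *)
exists (30 * (50 * 100) + 3)%N => I.
have [o [o_v o_max o_c]] := main_spec I.
have [|s [t [e v _ le_t]]] :=
    @exec_compile main_p [:: Var 0] 1 [:: encode_instance I]
      (initial (encode_instance I)).
  by split=> // s' ss'; rewrite /= ss'.
exists o; eexists; eexists; split.
- by apply: ExecSeq; [exact: e | exact: ExecAssign].
- by rewrite updateE /= v.
- exact: o_max.
have : (0 < input_size I ^ 2 * 8 ^ dim (resource I))%N.
  by rewrite muln_gt0 !expn_gt0 /input_size tree_size_gt0.
move: o_c le_t; rewrite -/(dim (resource I)) /=.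
by move: (_ * _ ^ _)%N => a; lia.
Qed.

Theorem theorem17 :
  solvable_in_O_star maxAPEP_SoD_U
    (fun k : nat => Rpower 2 (INR k + INR k * log2 (INR k))) /\
  solvable_in_O_star D_APEP_SoD_U
    (fun k : nat => Rpower 2 (INR k + INR k * log2 (INR k))).
Proof.
have [p [c solves]] := maxAPEP_solved_in_8k.
suff max_p : solvable_in_O_star maxAPEP_SoD_U
    (fun k : nat => Rpower 2 (INR k + INR k * log2 (INR k))).
  (* The same program decides existence: a maximum valid relation is valid, and the negative answer
     means the same in both problems. *)
  split=> //; have [q [c' [d q_max]]] := max_p; exists q, c', d => I.
  have [o [s [t [e v o_max le_t]]]] := q_max I; exists o, s, t; split=> //.
  by case: o o_max {v} => // A [].
(* The factor [8 ^ 4] comes from [pow8_le_Rpower], the degree 2 from the bound on the steps. *)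
exists p, (c * 8 ^ 4)%N, 2%N => I.
have [o [s [t [e v o_max le_t]]]] := solves I; exists o, s, t; split=> //.
apply: Rle_trans (_ : INR (c * input_size I ^ 2 * 8 ^ #|resource I|)%N <= _).
  by apply: le_INR; apply/leP; rewrite -mulnA.
rewrite (mulnAC c (8 ^ 4)%N) mult_INR [X in _ <= X * _]mult_INR Rmult_assoc.
apply: Rmult_le_compat_l; first exact: pos_INR.
exact: pow8_le_Rpower.
Qed.
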